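(* Let $d\ge 1$ and let $\Pi$ be any ergodic translation-invariant simple point process of unit intensity on $\mathbb{R}^d$, with law $\Lambda$ and Palm version of law $\Lambda^*$. Let $(\Pi,\Pi^*,Y)$ be any shift coupling, i.e. random elements on a common probability space such that $\Pi$ has law $\Lambda$, $\Pi^*$ has law $\Lambda^*$, $Y$ is $\mathbb{R}^d$-valued, and $\Pi=T^{Y}\Pi^*$ almost surely. Then $Y$ is not a function of $\Pi^*$; that is, there is no measurable function $h$ from configurations to $\mathbb{R}^d$ such that $Y=h(\Pi^* )$ almost surely.
   Context: Integer-valued (locally finite) Borel measures on $\mathbb{R}^d$ are called configurations; a point process is a random configuration, and it is simple if almost surely every atom has mass $1$. For $z\in\mathbb{R}^d$ and a configuration $\pi$, the translated configuration $T^{z}\pi$ is $(T^{z}\pi)(\cdot)=\pi(\cdot-z)$. Translation-invariance and ergodicity are with respect to the group of all translations of $\mathbb{R}^d$. The Palm version $\Pi^*$ of $\Pi$ is a random configuration whose law $\Lambda^*$ is characterized by $$\mathbf{E}\int_B f(T^{-s}\Pi)\,\Pi(ds)=\mathcal{L}(B)\,\mathbf{E}f(\Pi^* )$$ for every bounded measurable function $f$ on configurations and every Borel $B\subseteq\mathbb{R}^d$, where $\mathcal{L}$ is Lebesgue measure. *)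

(* Defs.v *)
From HB Require Import structures.
From mathcomp Require Import all_boot all_order all_algebra.
From mathcomp Require Import all_classical all_reals all_analysis.
From mathcomp Require Import measurable_realfun giry.

Set Implicit Arguments.
Unset Strict Implicit.
Unset Printing Implicit Defensive.

Import Order.TTheory GRing.Theory Num.Theory.
Import numFieldNormedType.Exports.

Local Open Scope classical_set_scope.
Local Open Scope ring_scope.

Section borel_matrix.
Context (R : realType) (m n : nat).

Definition borel_mx : set (set 'M[R]_(m, n)) := <<s (@open 'M[R]_(m, n)) >>.

HB.instance Definition _ :=
  @isMeasurable.Build (sigma_display (@open 'M[R]_(m, n))) 'M[R]_(m, n)
    borel_mx (@sigma_algebra0 _ setT _) (@sigma_algebraC _ _)
    (@sigma_algebra_bigcup _ setT _).

End borel_matrix.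

Section borel_matrix_lemmas.
Context (R : realType).

Lemma open_measurable_mx (m n : nat) (A : set 'M[R]_(m, n)) :
  open A -> measurable A.
Proof. exact: sub_gen_smallest. Qed.

Lemma measurable_fun_open_mx d (T : measurableType d) (m n : nat)
    (f : T -> 'M[R]_(m, n)) :
  (forall A, open A -> measurable (f @^-1` A)) -> measurable_fun setT f.
Proof.
move=> mf; apply: (@measurability _ _ _ _ setT f (@open 'M[R]_(m, n))) => //.
by move=> _ [A oA <-]; rewrite setTI; exact: mf.
Qed.

Lemma continuous_measurable_fun_mx (m n p q : nat)
    (f : 'M[R]_(m, n) -> 'M[R]_(p, q)) :
  continuous f -> measurable_fun setT f.
Proof.
move=> cf; apply: measurable_fun_open_mx => A oA.
by apply: open_measurable_mx; apply: open_comp => // x _; exact: cf.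
Qed.

Definition rat_box (m n : nat) (q : {ffun 'I_m * 'I_n -> rat * rat}) :
    set 'M[R]_(m, n) :=
  [set M | forall i j, M i j \in `]ratr (q (i, j)).1, ratr (q (i, j)).2[].

Lemma open_bigcup_rat_box (m n : nat) (A : set 'M[R]_(m, n)) : open A ->
  A = \bigcup_(q in [set q | rat_box q `<=` A]) rat_box q.
Proof.
move=> oA; apply/seteqP; split=> [x Ax|x [q qA qx]]; last exact: qA.
have /nbhs_ballP[e /= e0 eA] : nbhs x A by exact: open_nbhs_nbhs.
have H (ij : 'I_m * 'I_n) : exists q : rat * rat,
    [/\ x ij.1 ij.2 - e < ratr q.1, ratr q.1 < x ij.1 ij.2,
        x ij.1 ij.2 < ratr q.2 & ratr q.2 < x ij.1 ij.2 + e].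
  have xe : x ij.1 ij.2 - e < x ij.1 ij.2 by rewrite ltrBlDr ltrDl.
  have ex : x ij.1 ij.2 < x ij.1 ij.2 + e by rewrite ltrDl.
  have [a] := rat_in_itvoo xe; have [b] := rat_in_itvoo ex.
  by rewrite !in_itv/= => /andP[? ?] /andP[? ?]; exists (a, b).
have [g gP] := choice H.
exists [ffun ij => g ij] => [y yb|i j]; last first.
  by rewrite ffunE in_itv/=; have [_ -> ->] := gP (i, j).
apply: eA; split=> // i j; have := yb i j; rewrite ffunE in_itv/= => /andP[].
have [/= h1 _ _ h2] := gP (i, j) => h3 h4.
by rewrite /ball/= ltr_distlC (lt_trans h1 h3) (lt_trans h4 h2).
Qed.

Lemma measurable_fun_mx d (T : measurableType d) (m n : nat)
    (f : T -> 'M[R]_(m, n)) :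
  (forall i j, measurable_fun setT (fun t => f t i j)) -> measurable_fun setT f.
Proof.
move=> mf; apply: measurable_fun_open_mx => A oA.
rewrite (open_bigcup_rat_box oA) preimage_bigcup bigcup_mkcond.
apply: countable_bigcupT_measurable => [|q]; first exact: countableP.
case: ifPn => // _.
rewrite (_ : _ @^-1` _ = \bigcap_(ij in [set: 'I_m * 'I_n])
    ((fun t => f t ij.1 ij.2) @^-1` `]ratr (q ij).1, ratr (q ij).2[)).
  apply: fin_bigcap_measurable; first exact: finite_finset.
  by move=> ij _; rewrite -[X in measurable X]setTI; exact: mf.
apply/seteqP; split=> [t /= qt [i j] _|t qt i j]; first exact: (qt i j).
exact: (qt (i, j) I).
Qed.

Lemma measurable_coord (m n : nat) (i : 'I_m) (j : 'I_n) :
  measurable_fun setT (fun M : 'M[R]_(m, n) => M i j).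
Proof.
apply: (@measurability _ _ _ _ setT _ _ (RGenOpens.measurableE R)).
move=> _ [_ [a [b ->]] <-]; rewrite setTI; apply: open_measurable_mx.
apply: open_comp; last exact: interval_open.
by move=> M _; exact: coord_continuous.
Qed.

End borel_matrix_lemmas.

(* [pushforward] packed as a measure: its canonical instance cannot infer the
   measurability proof. *)
Definition image_measure d1 d2 (T1 : measurableType d1) (T2 : measurableType d2)
    (R : realType) (m : {measure set T1 -> \bar R}) (f : {mfun T1 >-> T2}) :
    {measure set T2 -> \bar R} :=
  measure_function_pushforward__canonical__measure_function_Measure m
    (@measurable_funPT _ _ _ _ f).

Lemma image_measureE d1 d2 (T1 : measurableType d1) (T2 : measurableType d2)
    (R : realType) (m : {measure set T1 -> \bar R}) (f : {mfun T1 >-> T2})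
    (A : set T2) : image_measure m f A = m (f @^-1` A).
Proof. by []. Qed.

Section lebesgue_rV.
Context (R : realType).

Definition cons_rV (n : nat) (xv : 'rV[R]_n * measurableTypeR R) : 'rV[R]_n.+1 :=
  row_mx (xv.2 : R)%:M xv.1.

Lemma measurable_cons_rV (n : nat) : measurable_fun setT (@cons_rV n).
Proof.
apply: measurable_fun_mx => i j; rewrite /cons_rV.
case: (@splitP 1 n j) => k jk.
  rewrite (_ : (fun _ => _) = snd); first exact: measurable_snd.
  apply/funext => -[v x] /=; rewrite (_ : j = lshift n k); last exact: val_inj.
  by rewrite (@row_mxEl _ _ 1) !ord1 mxE eqxx mulr1n.
rewrite (_ : (fun _ => _) = (fun v : 'rV[R]_n => v i k) \o fst).
  by apply: measurableT_comp => //; exact: measurable_coord.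
apply/funext => -[v x] /=; rewrite (_ : j = rshift 1 k); last exact: val_inj.
by rewrite (@row_mxEr _ _ 1).
Qed.

HB.instance Definition _ (n : nat) :=
  @isMeasurableFun.Build _ _ _ _ (@cons_rV n) (@measurable_cons_rV n).

(* The product of [d] copies of the one-dimensional Lebesgue measure. *)
Fixpoint lebesgue_rV (d : nat) : {measure set 'rV[R]_d -> \bar R} :=
  match d return {measure set 'rV[R]_d -> \bar R} with
  | 0%N => @dirac _ 'rV[R]_0 (0 : 'rV[R]_0) R
  | d'.+1 => image_measure (lebesgue_rV d' \x @lebesgue_measure R)%E
               (@cons_rV d')
  end.

Local Open Scope ereal_scope.

Lemma lebesgue_rV_box (d : nat) (A : 'I_d -> set R) :
  (forall i, measurable (A i)) ->
  lebesgue_rV d [set v : 'rV[R]_d | forall i, A i (v 0%R i)] =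
  \prod_(i < d) lebesgue_measure (A i).
Proof.
elim: d A => [|d IH] A mA /=.
  rewrite big_ord0 diracE mem_set// => -[].
  by case.
transitivity ((lebesgue_rV d \x @lebesgue_measure R)%E
    ([set v : 'rV[R]_d | forall i : 'I_d, A (lift ord0 i) (v 0%R i)] `*` A ord0)).
  rewrite image_measureE; congr (_ _); apply/seteqP; split=> -[v x] /=.
    move=> h; split=> [i|].
      have := h (lift ord0 i); rewrite /cons_rV/=.
      rewrite (_ : lift ord0 i = rshift 1 i); last exact: val_inj.
      by rewrite (@row_mxEr _ _ 1).
    have := h ord0; rewrite /cons_rV/=.
    rewrite (_ : ord0 = lshift d (ord0 : 'I_1)); last exact: val_inj.
    by rewrite (@row_mxEl _ _ 1) mxE.
  move=> [h1 h2] i; rewrite /cons_rV/=.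
  have [k ->|->] := unliftP ord0 i.
    move: (h1 k); rewrite (_ : lift ord0 k = rshift 1 k); last exact: val_inj.
    by rewrite (@row_mxEr _ _ 1).
  move: h2; rewrite (_ : ord0 = lshift d (ord0 : 'I_1)); last exact: val_inj.
  by rewrite (@row_mxEl _ _ 1) mxE.
rewrite product_measure1E.
- by rewrite (IH (fun i => A (lift ord0 i)))// big_ord_recl muleC.
- rewrite [X in measurable X](_ : _ = \bigcap_(i in [set: 'I_d])
      ((fun v : 'rV[R]_d => v 0%R i) @^-1` A (lift ord0 i))).
    apply: fin_bigcap_measurable; first exact: finite_finset.
    by move=> i _; rewrite -[X in measurable X]setTI; exact: measurable_coord.
  by apply/seteqP; split=> v /= h i; [move=> _; exact: h|exact: (h i I)].
- exact: mA.
Qed.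

End lebesgue_rV.

Section configuration.
Context (R : realType) (d : nat).
Local Open Scope ereal_scope.

(* The underlying set function of a measure is also defined (arbitrarily) on
   non-Borel sets, so configurations are to be compared with [≡μ], equality on
   Borel sets, rather than with [=]. *)
Record configuration := Configuration {
  cfg_measure :> {measure set 'rV[R]_d -> \bar R} ;
  cfg_integer : forall B : set 'rV[R]_d, measurable B ->
    cfg_measure B = +oo \/ exists n : nat, cfg_measure B = n%:R%:E ;
  cfg_locally_finite : forall B : set 'rV[R]_d, measurable B ->
    bounded_set B -> cfg_measure B < +oo }.

Let mzero_integer (B : set 'rV[R]_d) : measurable B ->
  (mzero : {measure set 'rV[R]_d -> \bar R}) B = +oo \/
  exists n : nat, (mzero : {measure set 'rV[R]_d -> \bar R}) B = n%:R%:E.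
Proof. by move=> _; right; exists 0%N. Qed.

Let mzero_locally_finite (B : set 'rV[R]_d) : measurable B -> bounded_set B ->
  (mzero : {measure set 'rV[R]_d -> \bar R}) B < +oo.
Proof. by move=> _ _; rewrite /= /mzero ltry. Qed.

HB.instance Definition _ := gen_eqMixin configuration.
HB.instance Definition _ := gen_choiceMixin configuration.
HB.instance Definition _ := isPointed.Build configuration
  (Configuration mzero_integer mzero_locally_finite).

(* The sigma-algebra generated by the evaluation maps pi |-> pi B, B Borel. *)
Definition cfg_generator : set (set configuration) :=
  \bigcup_(B in @measurable _ 'rV[R]_d)
    preimage_set_system setT (fun pi : configuration => pi B) measurable.

HB.instance Definition _ :=
  @isMeasurable.Build (sigma_display cfg_generator) configuration
    <<s cfg_generator >> (@sigma_algebra0 _ setT _) (@sigma_algebraC _ _)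
    (@sigma_algebra_bigcup _ setT _).

Definition shift_rV (z x : 'rV[R]_d) : 'rV[R]_d := (x + z)%R.

Lemma continuous_shift_rV z : continuous (shift_rV z).
Proof.
move=> x; apply: (@continuousD _ _ _ id (cst z)) => //.
exact: cst_continuous.
Qed.

HB.instance Definition _ (z : 'rV[R]_d) :=
  @isMeasurableFun.Build _ _ _ _ (shift_rV z)
    (continuous_measurable_fun_mx (@continuous_shift_rV z)).

Section translate.
Variables (z : 'rV[R]_d) (pi : configuration).

Let m : {measure set 'rV[R]_d -> \bar R} := image_measure pi (shift_rV z).

Let m_integer (B : set 'rV[R]_d) : measurable B ->
  m B = +oo \/ exists n : nat, m B = n%:R%:E.
Proof.
move=> mB; apply: cfg_integer; rewrite -[X in measurable X]setTI.
exact: measurable_funPT.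
Qed.

Let m_locally_finite (B : set 'rV[R]_d) : measurable B -> bounded_set B ->
  m B < +oo.
Proof.
move=> mB [M [Mreal BM]]; apply: cfg_locally_finite.
  by rewrite -[X in measurable X]setTI; exact: measurable_funPT.
exists (M + `|z|)%R; split; first exact: num_real.
move=> x Mx y /= yB; rewrite -(addrK z y) (le_trans (ler_normB _ _))// -lerBrDr.
by apply: (BM (x - `|z|)%R) => //; rewrite ltrBrDr.
Qed.

(* The preimage of B under x |-> x + z is B - z. *)
Definition translate : configuration :=
  Configuration m_integer m_locally_finite.

Lemma translateE (B : set 'rV[R]_d) : translate B = pi [set (b - z)%R | b in B].
Proof.
rewrite /= image_measureE; congr (pi _); apply/seteqP.
split=> [x Bx|_ [b Bb <-]]; first by exists (x + z)%R => //; rewrite addrK.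
by rewrite /= /shift_rV subrK.
Qed.

End translate.

End configuration.

Section point_process.
Context (R : realType) (d : nat).
Implicit Types L Lstar : probability (configuration R d) R.
Local Open Scope ereal_scope.

Definition translation_invariant L :=
  forall (z : 'rV[R]_d) (A : set (configuration R d)), measurable A ->
    L (translate z @^-1` A) = L A.

Definition ergodic L :=
  forall A : set (configuration R d), measurable A ->
    (forall z : 'rV[R]_d, translate z @^-1` A = A) -> L A = 0 \/ L A = 1.

Definition simple L :=
  {ae L, forall pi : configuration R d,
    forall x : 'rV[R]_d, pi [set x] != 0 -> pi [set x] = 1}.

Definition has_intensity L (lambda : R) :=
  forall B : set 'rV[R]_d, measurable B ->
    \int[L]_pi (pi : configuration R d) B = lambda%:E * lebesgue_rV R d B.

(* For signed [f] the formula is only imposed when [B] has finite volume, so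
   that the left-hand side is not of the form oo - oo. *)
Definition palm_version L Lstar :=
  forall (f : configuration R d -> R) (B : set 'rV[R]_d),
    measurable_fun setT f -> (exists M : R, forall pi, (`|f pi| <= M)%R) ->
    measurable B ->
    (forall pi, (0 <= f pi)%R) \/ lebesgue_rV R d B < +oo ->
    \int[L]_pi \int[pi : configuration R d]_(s in B)
      (f (translate (- s)%R pi))%:E
    = lebesgue_rV R d B * \int[Lstar]_pi (f pi)%:E.

Definition shift_coupling L Lstar
    d' (Omega : measurableType d') (P : probability Omega R)
    (Pi Pistar : {RV P >-> configuration R d}) (Y : {RV P >-> 'rV[R]_d}) :=
  [/\ distribution P Pi ≡μ L, distribution P Pistar ≡μ Lstar &
      {ae P, forall w, Pi w ≡μ translate (Y w) (Pistar w)}].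

End point_process.

(* Main.v *)
From HB Require Import structures.
Require Import Defs.
From mathcomp Require Import all_boot all_order all_algebra.
From mathcomp Require Import all_classical all_reals all_analysis.
From mathcomp Require Import measurable_realfun giry.
From mathcomp Require Import lra.

(** Suppose that [Y = h Pistar] almost surely. Let each point [s] of the process
    [Pi] single out the location [s - h (T^-s Pi)]. As [Pi = T^Y Pistar] and
    [Pistar] has an atom at the origin, [Y] is a point of [Pi], and it singles
    out the location [Y - h Pistar = 0]. So almost surely the origin is among the
    countably many locations singled out by the points of [Pi], whereas the Palm
    formula says that this happens with probability zero.

    The Palm formula is applied on boxes. For a Borel set [B] of [R^d], let
    [G pi] be the mass that [pi] gives to the locations [s] in [B] such that
    [h (T^-s pi)] is in [B] ([palm_points]). The Palm formula reads
    [E (G Pi) = vol B * P (h Pistar \in B)] ([palm_points_mass]), and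
    [G Pi >= 1] as soon as [h Pistar] is in [B] ([shift_to_palm_point]); hence
    [P (h Pistar \in B) <= vol B * P (h Pistar \in B)], which forces
    [P (h Pistar \in B) = 0] when [vol B < 1]. For [d > 0], countably many such
    sets cover [R^d], a contradiction.

    Two facts support this. The map [G] is measurable, because the mass given by
    a measurable family of configurations to the sections of a measurable set is
    measurable ([measurable_cfg_xsection]). And [Pistar] has an atom at the origin
    almost surely ([palm_version_atom0]), by the Palm formula and the fact that a
    configuration is purely atomic ([negligible_non_atoms]). *)

Set Implicit Arguments.
Unset Strict Implicit.
Unset Printing Implicit Defensive.

Import Order.TTheory GRing.Theory Num.Theory.
Import numFieldNormedType.Exports.

Local Open Scope classical_set_scope.
Local Open Scope ring_scope.

(** * Borel subsets of Euclidean space *)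

Section borel_rV.
Context (R : realType) (d : nat).

Lemma measurable_rV_box (A : 'I_d -> set R) : (forall i, measurable (A i)) ->
  measurable [set v : 'rV[R]_d | forall i, A i (v 0 i)].
Proof.
move=> mA; rewrite [X in measurable X](_ : _ = \bigcap_(i in [set: 'I_d])
    ((fun v : 'rV[R]_d => v 0 i) @^-1` A i)); last first.
  by apply/seteqP; split=> v /= h i; [move=> _; exact: h|exact: (h i I)].
apply: fin_bigcap_measurable; first exact: finite_finset.
by move=> i _; rewrite -[X in measurable X]setTI; exact: measurable_coord.
Qed.

Lemma measurable_rV1 (v : 'rV[R]_d) : measurable [set v].
Proof.
rewrite (_ : [set v] = [set w | forall i, [set v 0 i] (w 0 i)]).
  apply: (@measurable_rV_box (fun i => [set v 0 i])) => i.
  exact: measurable_set1.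
by apply/seteqP; split=> [_ -> //|w /= vw]; apply/rowP => i; exact: vw.
Qed.

Lemma measurable_fun_rV_sub d1 (T : measurableType d1) (f g : T -> 'rV[R]_d) :
  measurable_fun setT f -> measurable_fun setT g ->
  measurable_fun setT (fun t => f t - g t).
Proof.
move=> mf mg; apply: measurable_fun_mx => i j.
rewrite [X in measurable_fun _ X](_ : _ = (fun t => f t i j - g t i j));
  last first.
  by apply/funext => t; rewrite !mxE.
by apply: measurable_funB;
  [exact: measurableT_comp (measurable_coord i j) mf|
   exact: measurableT_comp (measurable_coord i j) mg].
Qed.

(** The open cube of side [1/2] with rational centre [q]. The side matters only
    in that the volume [2^-d] is positive, and less than [1] when [d > 0]. *)
Definition half_box (q : {ffun 'I_d -> rat}) : set 'rV[R]_d :=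
  [set v | forall i,
    `]ratr (q i) - 4^-1, ratr (q i) + 4^-1[%classic (v 0 i)].

Lemma measurable_half_box q : measurable (half_box q).
Proof.
apply: (@measurable_rV_box (fun i =>
  `]ratr (q i) - 4^-1, ratr (q i) + 4^-1[%classic)) => i.
exact: measurable_itv.
Qed.

Lemma lebesgue_half_box q : lebesgue_rV R d (half_box q) = (2^-1 ^+ d)%:E.
Proof.
rewrite (@lebesgue_rV_box R d (fun i =>
  `]ratr (q i) - 4^-1, ratr (q i) + 4^-1[%classic))//.
rewrite (eq_bigr (fun=> (2^-1 : R)%:E)) => [|i _]; last first.
  rewrite lebesgue_measure_itv/= lte_fin ifT; last by lra.
  by rewrite -EFinB; congr (_%:E); lra.
by rewrite prodEFin prodr_const card_ord.
Qed.

Lemma half_box_cover : \bigcup_q half_box q = setT.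
Proof.
apply/seteqP; split=> // v _.
have H (i : 'I_d) : exists q : rat,
    v 0 i \in `]ratr q - 4^-1, ratr q + 4^-1[.
  have [|q] := @rat_in_itvoo R (v 0 i - 4^-1) (v 0 i + 4^-1); first by lra.
  rewrite in_itv/= => /andP[h1 h2]; exists q.
  by rewrite in_itv/=; apply/andP; split; lra.
have [g gP] := choice H; exists [ffun i => g i] => // i.
by rewrite ffunE; exact: gP.
Qed.

End borel_rV.

Lemma negligible_bigcup_countType (R : realType) d (T : measurableType d)
    (mu : {measure set T -> \bar R}) (I : countType) (D : set I)
    (F : I -> set T) :
  (forall i, D i -> mu.-negligible (F i)) ->
  mu.-negligible (\bigcup_(i in D) F i).
Proof.
move=> F0.
pose G n := if unpickle n is Some i then (if `[< D i >] then F i else set0)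
            else set0.
apply: (@negligibleS _ _ _ mu (\bigcup_n G n)) => [x [i Di Fix]|].
  by exists (pickle i) => //; rewrite /G pickleK; case: ifPn => // /asboolP.
apply: negligible_bigcup => n; rewrite /G.
case: unpickle => [i|]; last exact: negligible_set0.
by case: ifPn => [/asboolP/F0|_] //; exact: negligible_set0.
Qed.

(** * The sigma-algebra on configurations *)

Section configuration_sigma_algebra.
Context (R : realType) (d : nat).
Implicit Types (pi : configuration R d) (B : set 'rV[R]_d).

Lemma measurable_cfg_eval B : measurable B ->
  measurable_fun setT (fun pi : configuration R d => pi B).
Proof.
move=> mB _ V mV; apply: sub_gen_smallest; exists B => //.
by exists V.
Qed.

Lemma measurable_fun_cfg d1 (T : measurableType d1)
    (c : T -> configuration R d) :
  (forall B, measurable B -> measurable_fun setT (fun t => c t B)) ->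
  measurable_fun setT c.
Proof.
move=> mc; apply: (@measurability _ _ _ _ setT c (@cfg_generator R d)) => //.
move=> _ [_ [B mB [V mV <-]] <-]; rewrite !setTI -[X in measurable X]setTI.
exact: mc.
Qed.

(** Configurations that agree on Borel sets are not separated by the
    sigma-algebra on configurations: the events that do not separate them form a
    sigma-algebra that contains its generators. *)
Lemma measurable_cfg_eq pi1 pi2 (E : set (configuration R d)) :
  pi1 ≡μ pi2 -> measurable E -> E pi1 -> E pi2.
Proof.
move=> e12 mE; suff: E pi1 <-> E pi2 by case.
pose sep : set (set (configuration R d)) := [set F | F pi1 <-> F pi2].
have ssep : sigma_algebra setT sep.
  split=> [|F [F1 F2]|F sF]; first by split.
  - by split=> -[_ nF]; split=> // ?; apply: nF; [exact: F2|exact: F1].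
  - by split=> -[n _ Fn]; exists n => //; apply/(sF n).
apply: (@smallest_sub _ _ (@cfg_generator R d) sep ssep _ _ mE).
move=> _ [B mB [V mV <-]]; rewrite setTI; have := e12 _ mB.
by rewrite /sep/= => ->.
Qed.

Lemma measurable_no_atom (s : 'rV[R]_d) :
  measurable [set pi : configuration R d | pi [set s] = 0%E].
Proof.
rewrite -[X in measurable X]setTI.
exact: (measurable_cfg_eval (measurable_rV1 s) measurableT
  (emeasurable_set1 0%E)).
Qed.

End configuration_sigma_algebra.

(** * Measurability of masses of sections *)

Section random_configuration_kernel.
Context (R : realType) (d : nat) d1 (T : measurableType d1).
Variables (c : T -> configuration R d) (mc : measurable_fun setT c).
Local Open Scope ereal_scope.

(** A measurable family of configurations, seen as a transition kernel. *)
Definition cfg_kernel (t : T) : {measure set 'rV[R]_d -> \bar R} := c t.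

Let measurable_cfg_kernel U : measurable U ->
  measurable_fun setT (cfg_kernel ^~ U).
Proof. by move=> mU; exact: measurableT_comp (measurable_cfg_eval mU) mc. Qed.

HB.instance Definition _ :=
  @isKernel.Build _ _ _ _ R cfg_kernel measurable_cfg_kernel.

Let closed_ball0 (n : nat) : set 'rV[R]_d := [set v | (`|v| <= n%:R)%R].

Let measurable_closed_ball0 n : measurable (closed_ball0 n).
Proof.
rewrite (_ : closed_ball0 n = ~` [set v | (n%:R < `|v|)%R]).
  apply: measurableC; apply: open_measurable_mx.
  apply: (@open_comp _ _ (@Num.norm R 'rV[R]_d) [set x | (n%:R < x)%R]).
    by move=> v _; exact: norm_continuous.
  exact: open_gt.
by apply/seteqP; split=> v; rewrite /closed_ball0 /= leNgt => /negP.
Qed.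

(** The masses given to sections depend measurably on the parameter. This is
    known for measures that are finite on a fixed set, so the sections are first
    cut by a closed ball, where configurations are finite; the radius then tends
    to infinity. *)
Lemma measurable_cfg_xsection (A : set (T * 'rV[R]_d)) : measurable A ->
  measurable_fun setT (fun t => c t (xsection A t)).
Proof.
move=> mA.
apply: (@emeasurable_fun_cvg _ _ _ _
    (fun n t => c t (xsection A t `&` closed_ball0 n))) => [n|t _].
  have H : forall t, exists M : R, forall X, measurable X ->
      mrestr (cfg_kernel t) (measurable_closed_ball0 n) X < M%:E.
    move=> t; have bn : c t (closed_ball0 n) < +oo.
      apply: cfg_locally_finite => //.
      exists n%:R; split; first exact: num_real.
      by move=> x nx v /= /le_trans; apply; exact: ltW.
    exists (fine (c t (closed_ball0 n)) + 1)%R => X mX.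
    rewrite EFinD fineK ?ge0_fin_numE//.
    apply: (@le_lt_trans _ _ (c t (closed_ball0 n))); last first.
      by rewrite lteDl ?ge0_fin_numE// lte_fin.
    by rewrite /mrestr le_measure ?inE//; exact: measurableI.
  by have [] := measurable_prod_subset_xsection_kernel H mA.
have -> : c t (xsection A t) =
    c t (\bigcup_n (xsection A t `&` closed_ball0 n)).
  congr (c t _); rewrite -setI_bigcupr (_ : \bigcup_n _ = setT) ?setIT//.
  apply/seteqP; split=> // v _; exists (Num.truncn `|v|).+1 => //=.
  by rewrite /closed_ball0/= ltW// truncnS_gt.
have mAt := @measurable_xsection _ _ _ _ A t mA.
apply: nondecreasing_cvg_mu => [n||m n mn]; first exact: measurableI.
  by apply: bigcup_measurable => n _; exact: measurableI.
apply/subsetPset => v /= [Av vm]; split=> //.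
by apply: le_trans vm _; rewrite ler_nat.
Qed.

End random_configuration_kernel.

(** * The Palm formula for events *)

Section palm_points.
Context (R : realType) (d : nat).
Local Open Scope ereal_scope.

(** Joint measurability of [(pi, s) |-> T^-s pi]: the mass given to [B] by
    [T^-s pi] is the mass given by [pi] to the [x] with [x - s] in [B], the
    section at [(pi, s)] of a measurable set. *)
Lemma measurable_translate_pair :
  measurable_fun [set: configuration R d * 'rV[R]_d]
    (fun ps => translate (- ps.2)%R ps.1).
Proof.
apply: measurable_fun_cfg => B mB.
pose A : set ((configuration R d * 'rV[R]_d) * 'rV[R]_d) :=
  [set u | B (u.2 - u.1.2)%R].
have mA : measurable A.
  rewrite -[X in measurable X]setTI.
  have : measurable_fun setT
      (fun u : (configuration R d * 'rV[R]_d) * 'rV[R]_d => u.2 - u.1.2)%R.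
    apply: measurable_fun_rV_sub; first exact: measurable_snd.
    exact: measurableT_comp measurable_snd measurable_fst.
  by move=> /(_ measurableT B mB).
rewrite [X in measurable_fun _ X](_ : _ =
    (fun ps : configuration R d * 'rV[R]_d => ps.1 (xsection A ps))).
  by apply: measurable_cfg_xsection => //; exact: measurable_fst.
apply/funext => -[pi s] /=; rewrite image_measureE; congr (pi _).
by apply/seteqP; split=> x; rewrite /xsection/= inE.
Qed.

(** The locations [s] in [B] from which, once [s] is moved to the origin, the
    configuration [pi] is seen to be in [E]. *)
Definition palm_points (E : set (configuration R d)) (B : set 'rV[R]_d)
    (pi : configuration R d) : set 'rV[R]_d :=
  [set s | E (translate (- s)%R pi)] `&` B.

Variables (E : set (configuration R d)) (B : set 'rV[R]_d).
Hypotheses (mE : measurable E) (mB : measurable B).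

Lemma measurable_palm_points pi : measurable (palm_points E B pi).
Proof.
apply: measurableI => //; rewrite -[X in measurable X]setTI.
have := measurable_fun_pair2 pi measurable_translate_pair.
by move=> /(_ measurableT E mE).
Qed.

Lemma measurable_palm_points_mass :
  measurable_fun setT (fun pi : configuration R d => pi (palm_points E B pi)).
Proof.
pose A : set (configuration R d * 'rV[R]_d) :=
  [set ps | E (translate (- ps.2)%R ps.1)] `&` [set ps | B ps.2].
have mA : measurable A.
  apply: measurableI; rewrite -[X in measurable X]setTI.
    exact: measurable_translate_pair.
  by apply: (@measurable_snd _ _ (configuration R d) 'rV[R]_d).
rewrite [X in measurable_fun _ X](_ : _ =
    (fun pi : configuration R d => pi (xsection A pi))).
  by apply: (measurable_cfg_xsection (c := id)).
apply/funext => pi; congr (pi _).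
by apply/seteqP; split=> x; rewrite /xsection/= inE.
Qed.

(** The Palm formula for the indicator of [E]. *)
Lemma palm_points_mass (L Lstar : probability (configuration R d) R) :
  palm_version L Lstar ->
  \int[L]_pi (pi : configuration R d) (palm_points E B pi) =
  lebesgue_rV R d B * Lstar E.
Proof.
move=> palm.
have -> : Lstar E = \int[Lstar]_pi (\1_E pi)%:E.
  by rewrite integral_indic// setIT.
rewrite -palm//; first last.
- by left=> pi; rewrite indicE ler0n.
- by exists 1%R => pi; rewrite indicE; case: (_ \in _); rewrite ?normr1 ?normr0.
apply: eq_integral => pi _.
rewrite /palm_points -integral_indic//.
rewrite -[X in measurable X]setTI.
by have := measurable_fun_pair2 pi measurable_translate_pair; apply.
Qed.

End palm_points.

(** * Atoms *)

Section palm_atom.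
Context (R : realType) (d : nat).
Local Open Scope ereal_scope.

Lemma cfg_lt1_eq0 (pi : configuration R d) (B : set 'rV[R]_d) :
  measurable B -> pi B < 1 -> pi B = 0.
Proof.
move=> mB; have [->|[n ->]] := cfg_integer pi mB; first by [].
by rewrite lte_fin -[1%R]/(1%:R) ltr_nat ltnS leqn0 => /eqP ->.
Qed.

(** An integer-valued locally finite measure is purely atomic: a non-atom has a
    null neighbourhood by continuity from above, and countably many rational
    boxes inside such neighbourhoods cover all non-atoms. *)
Lemma negligible_non_atoms (pi : configuration R d) :
  (pi : {measure set 'rV[R]_d -> \bar R}).-negligible
    [set s | pi [set s] = 0].
Proof.
set mu := (X in X.-negligible _).
pose N := [set q | mu.-negligible (@rat_box R 1 d q)].
apply: (@negligibleS _ _ _ mu (\bigcup_(q in N) @rat_box R 1 d q)); last first.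
  exact: negligible_bigcup_countType.
move=> s /= s0.
pose V n : set 'rV[R]_d := ball s (n.+1%:R^-1 : R).
have mV n : measurable (V n) by apply: open_measurable_mx; exact: ball_open.
have capV : \bigcap_n V n = [set s].
  apply/seteqP; split=> [x Vx|_ -> n _]; last exact: ballxx.
  apply/eqP; apply: contraT; rewrite -subr_eq0 -normr_gt0 => xs0.
  have [n _ /(_ n (leqnn n))/= nx] := near_infty_natSinv_lt (PosNum xs0).
  have := Vx n I; rewrite /V -ball_normE/= distrC => /lt_trans/(_ nx).
  by rewrite ltxx.
have Vty : pi (V 0%N) < +oo.
  apply: cfg_locally_finite => //.
  exists (`|s| + 1)%R; split; first exact: num_real.
  move=> x sx v; rewrite /V -ball_normE/= invr1 distrC => vs.
  rewrite (le_trans _ (ltW sx))// -(subrK s v) (le_trans (ler_normD _ _))//.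
  by rewrite addrC lerD2l ltW.
have niV : nonincreasing_seq V.
  move=> m n mn; apply/subsetPset; apply: le_ball.
  by rewrite lef_pV2 ?posrE// ler_nat.
have Vcvg : pi (V n) @[n --> \oo] --> (0 : \bar R).
  rewrite -s0 -capV; apply: (@nonincreasing_cvg_mu _ _ _ mu) => //.
  by rewrite capV; exact: measurable_rV1.
have [n piVn] : exists n, pi (V n) = 0.
  apply: contrapT => /forallNP nz.
  have : (1 : \bar R) <= lim (pi (V n) @[n --> \oo]).
    apply: lime_ge; first by apply/cvg_ex; exists 0.
    apply: nearW => n; rewrite leNgt; apply/negP => /(cfg_lt1_eq0 (mV n)).
    exact: nz.
  by rewrite (cvg_lim _ Vcvg)// lee_fin ler10.
have : V n s by exact: ballxx.
have oV : open (V n) by exact: ball_open.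
rewrite (open_bigcup_rat_box oV) => -[q /= qV qs].
exists q => //; rewrite /N/=.
by apply: negligibleS qV _; exact/negligibleP.
Qed.

(** The Palm version almost surely has an atom at the origin: in the Palm
    formula for the event of having none, the mass integrated on the left is that
    of a set of non-atoms, hence zero. *)
Lemma palm_version_atom0 (L Lstar : probability (configuration R d) R) :
  palm_version L Lstar ->
  Lstar [set pi : configuration R d | pi [set 0%R] = 0] = 0.
Proof.
set E := [set pi : configuration R d | _] => palm.
have mE : measurable E := measurable_no_atom 0%R.
pose q0 : {ffun 'I_d -> rat} := [ffun=> 0%R].
have /eqP := palm_points_mass mE (measurable_half_box q0) palm.
rewrite lebesgue_half_box integral0_eq => [|pi _]; last first.
  apply/negligibleP.
    exact: measurable_palm_points mE (measurable_half_box _) _.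
  apply: negligibleS (negligible_non_atoms pi) => s [Es _].
  move: Es; rewrite /E /= image_measureE => <-; congr (pi _).
  apply/seteqP; split=> [_ ->|x] /=; rewrite /shift_rV ?subrr//.
  by move/eqP; rewrite subr_eq0 => /eqP.
rewrite eq_sym mule_eq0 eqe expf_eq0 invr_eq0 pnatr_eq0 andbF/=.
by move/eqP.
Qed.

End palm_atom.

(** * Shift couplings *)

Section palm_point_of_shift.
Context (R : realType) (d : nat).
Local Open Scope ereal_scope.

Lemma translateK (y : 'rV[R]_d) (pi pi' : configuration R d) :
  pi' ≡μ translate y pi -> translate (- y)%R pi' ≡μ pi.
Proof.
move=> e B mB; rewrite /= image_measureE e; last first.
  by rewrite -[X in measurable X]setTI; exact: measurable_funPT.
rewrite /= image_measureE; congr (pi _).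
by apply/seteqP; split=> x; rewrite /= /shift_rV addrK.
Qed.

(** If [pi] is [pistar] translated by [h pistar], then [h pistar] is an atom of
    [pi], being the image of the origin, and moving it back to the origin recovers
    [pistar], so that [h] takes the value [h pistar] there. *)
Lemma shift_to_palm_point (h : configuration R d -> 'rV[R]_d) (B : set 'rV[R]_d)
    (pi pistar : configuration R d) :
  measurable_fun setT h -> measurable B ->
  pi ≡μ translate (h pistar) pistar -> pistar [set 0%R] != 0 -> B (h pistar) ->
  1 <= pi (palm_points (h @^-1` B) B pi).
Proof.
move=> mh mB e n0 Bh.
have mE : measurable (h @^-1` B).
  by rewrite -[X in measurable X]setTI; exact: mh.
have m1 := measurable_rV1 (h pistar).
apply: (@le_trans _ _ (pi [set h pistar])).
  rewrite leNgt; apply/negP => /(cfg_lt1_eq0 m1) pi0.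
  move/negP: n0; apply; rewrite -pi0 e// /= image_measureE; apply/eqP.
  congr (pistar _).
  apply/seteqP; split=> [_ ->|x] /=; rewrite /shift_rV ?add0r//.
  by rewrite -[X in _ = X -> _]add0r => /addIr.
apply: le_measure; rewrite ?inE//; first exact: measurable_palm_points.
move=> _ ->; split=> //.
apply: (measurable_cfg_eq (pi1 := pistar)) => // A mA.
by rewrite (translateK e).
Qed.

End palm_point_of_shift.

(** * Non-existence *)

Theorem proposition2 (R : realType) (d : nat) (d_gt0 : (0 < d)%N)
    (Lambda Lambdastar : probability (configuration R d) R)
    (Lambda_invariant : translation_invariant Lambda)
    (Lambda_ergodic : ergodic Lambda)
    (Lambda_simple : simple Lambda)
    (Lambda_intensity : has_intensity Lambda 1%R)
    (Lambda_palm : palm_version Lambda Lambdastar)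
    (d' : measure_display) (Omega : measurableType d')
    (P : probability Omega R)
    (Pi Pistar : {RV P >-> configuration R d}) (Y : {RV P >-> 'rV[R]_d})
    (coupling : shift_coupling Lambda Lambdastar Pi Pistar Y) :
  ~ exists h : configuration R d -> 'rV[R]_d,
      measurable_fun setT h /\ {ae P, forall w, Y w = h (Pistar w)}.
Proof.
move=> [h [mh Yh]]; have [PiL PistarL PiY] := coupling.
have mhB (B : set 'rV[R]_d) : measurable B -> measurable (h @^-1` B).
  by move=> mB; rewrite -[X in measurable X]setTI; exact: mh.
have mpre d1 (T : measurableType d1) (X : {RV P >-> T}) A : measurable A ->
    measurable (X @^-1` A).
  by move=> mA; rewrite -[X in measurable X]setTI; exact: measurable_funPT.
have atom0 : {ae P, forall w, (Pistar w [set 0%R] != 0)%E}.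
  have mE := @measurable_no_atom R d 0.
  exists (Pistar @^-1` [set pi | pi [set 0] = 0%E]); split; first exact: mpre.
    rewrite -[LHS]/(distribution P Pistar [set pi | pi [set 0] = 0%E]) PistarL//.
    exact: palm_version_atom0 Lambda_palm.
  by move=> w /= /negP; rewrite negbK => /eqP.
have key (B : set 'rV[R]_d) : measurable B ->
    (Lambdastar (h @^-1` B) <= lebesgue_rV R d B * Lambdastar (h @^-1` B))%E.
  move=> mB.
  pose G (pi : configuration R d) := pi (palm_points (h @^-1` B) B pi).
  have mG : measurable_fun setT G.
    exact: measurable_palm_points_mass (mhB _ mB) mB.
  rewrite -(palm_points_mass (mhB _ mB) mB Lambda_palm).
  have mG1 : measurable [set pi | (1%:E <= G pi)%E].
    by rewrite -[X in measurable X]setTI; exact: emeasurable_fun_c_infty.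
  apply: (@le_trans _ _ (Lambda [set pi | (1%:E <= G pi)%E])).
    rewrite -PistarL; last exact: mhB.
    rewrite -PiL //.
    rewrite -[leLHS]/(P (Pistar @^-1` (h @^-1` B))).
    rewrite -[leRHS]/(P (Pi @^-1` [set pi | (1%:E <= G pi)%E])).
    have mC := mpre _ _ Pi _ mG1.
    (* a null set outside of which the three almost sure facts hold *)
    have [N [mN PN NP]] := filterI PiY (filterI Yh atom0).
    rewrite (@le_trans _ _ (P (Pi @^-1` [set pi | (1%:E <= G pi)%E] `|` N)))//.
      apply: le_measure; rewrite ?inE; first by apply: mpre; exact: mhB.
        exact: measurableU.
      move=> w /= Bw; have [Nw|nNw] := pselect (N w); [by right|left].
      have [e [Yw a0]] := contrapT (fun nw => nNw (NP w nw)).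
      by rewrite Yw in e; exact: (shift_to_palm_point mh mB e a0 Bw).
    by rewrite (le_trans (measureU2 _ _ _))// [X in (_ + X)%E]PN adde0.
  (* Markov's inequality at level 1 *)
  have := le_integral_abse Lambda measurableT mG ltr01.
  rewrite mul1e setTI.
  have G0 pi : (`|G pi| = G pi)%E by rewrite gee0_abs.
  under eq_set do rewrite G0.
  by under eq_integral do rewrite G0.
have null (q : {ffun 'I_d -> rat}) : Lambdastar (h @^-1` half_box q) = 0%E.
  have := key _ (measurable_half_box q); rewrite lebesgue_half_box.
  have : Lambdastar (h @^-1` half_box q) \is a fin_num.
    exact: fin_num_measure (mhB _ (measurable_half_box q)).
  move=> /fineK <-; rewrite -EFinM lee_fin => xle; congr (_%:E).
  apply: le_anti; rewrite fine_ge0// andbT.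
  have vol1 : 2^-1 ^+ d < 1 :> R by rewrite exprn_ilt1 -?lt0n//; lra.
  rewrite -(@pmulr_rle0 _ (1 - 2^-1 ^+ d)) ?subr_gt0//.
  by rewrite mulrBl mul1r subr_le0.
have : Lambdastar.-negligible setT.
  rewrite -(preimage_setT h) -half_box_cover preimage_bigcup.
  apply: negligible_bigcup_countType => q _; apply/negligibleP; last exact: null.
  by apply: mhB; exact: measurable_half_box.
move=> /(negligibleP _ measurableT)/eqP.
by rewrite -[X in X == _]/(Lambdastar setT) probability_setT eqe oner_eq0.
Qed.
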